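(* Let $n\ge 6$ and let $\Pi_n\subseteq\mathbb{R}^n$ be the permutahedron. Then there is no symmetric extended formulation of $\Pi_n$ (symmetric with respect to the group $G=S_n$ acting on the vertex set of $\Pi_n$ by permuting coordinates) with fewer than $\frac{n(n-1)}{4}$ variables and constraints, i.e. for every such formulation the number of its variables plus the number of its constraints is at least $\frac{n(n-1)}{4}$.
   Context: The permutahedron $\Pi_n$ is the convex hull of all points of $\mathbb{R}^n$ obtained from $(1,2,\dots,n)$ by permuting coordinates; its vertex set is $X=\{(\zeta^{-1}(1),\dots,\zeta^{-1}(n)) : \zeta\in S_n\}$. The group $S_n$ acts on $\mathbb{R}^n$ (and on $X$) by $(\pi.x)_v=x_{\pi^{-1}(v)}$; similarly $S_d$ acts on $\mathbb{R}^d$ by permuting coordinates. An extension of a polytope $P\subseteq\mathbb{R}^m$ is a polyhedron $Q\subseteq\mathbb{R}^d$ together with a linear map $p:\mathbb{R}^d\to\mathbb{R}^m$ with $p(Q)=P$; an extended formulation of $P$ is a finite system $A^{=}y=b^{=}$, $A^{\le}y\le b^{\le}$ whose solution set $Q$ is an extension of $P$ (with some linear map $p$). Such an extended formulation is symmetric with respect to a group $G\subseteq S_m$ acting on the vertex set $X$ of $P$ if for every $\pi\in G$ there are a permutation $\varkappa_\pi\in S_d$ with $p(\varkappa_\pi.y)=\pi.p(y)$ for all $y\in p^{-1}(X)$, and permutations $\varrho^{=}_\pi,\varrho^{\le}_\pi$ of the rows of $(A^{=},b^{=})$ and $(A^{\le},b^{\le})$ respectively, such that simultaneously permuting the columns (of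 $A^{=}$, $A^{\le}$) by $\varkappa_\pi$ and the rows by $\varrho^{=}_\pi$, $\varrho^{\le}_\pi$ leaves $(A^{=},b^{=})$ and $(A^{\le},b^{\le})$ unchanged. *)

(* Defs.v *)
From HB Require Import structures.
From mathcomp Require Import all_boot all_order all_algebra all_fingroup.
From mathcomp Require Import reals.
Set Implicit Arguments. Unset Strict Implicit. Unset Printing Implicit Defensive.
Import Order.TTheory GRing.Theory Num.Theory.
Local Open Scope ring_scope.

Section Permutahedron.
Variable R : realType.

Definition act_cV k (s : 'S_k) (x : 'cV[R]_k) : 'cV[R]_k :=
  \col_v x ((s^-1)%g v) 0.

(* Vertex of the permutahedron associated to zeta (0-based indices v, values
   zeta^-1(v)+1 in {1..n}). *)
Definition perm_vertex n (zeta : 'S_n) : 'cV[R]_n :=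
  \col_v (((zeta^-1)%g v).+1)%:R.

Definition perm_vertices n (x : 'cV[R]_n) : Prop :=
  exists zeta : 'S_n, x = perm_vertex zeta.

Definition permutahedron n (x : 'cV[R]_n) : Prop :=
  exists lam : 'S_n -> R,
    (forall zeta, 0 <= lam zeta) /\ \sum_zeta lam zeta = 1 /\
    x = \sum_zeta lam zeta *: perm_vertex zeta.

Definition EF_sol d m1 m2 (Aeq : 'M[R]_(m1, d)) (beq : 'cV[R]_m1)
  (Ale : 'M[R]_(m2, d)) (ble : 'cV[R]_m2) (y : 'cV[R]_d) : Prop :=
  Aeq *m y = beq /\ forall i, (Ale *m y) i 0 <= ble i 0.

Definition is_extended_formulation m (P : 'cV[R]_m -> Prop) d m1 m2
  (Aeq : 'M[R]_(m1, d)) (beq : 'cV[R]_m1)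
  (Ale : 'M[R]_(m2, d)) (ble : 'cV[R]_m2) (p : 'M[R]_(m, d)) : Prop :=
  forall x, P x <-> exists y, EF_sol Aeq beq Ale ble y /\ p *m y = x.

(* Symmetry with respect to the group G (a set of permutations of 'I_m)
   acting on the vertex set X. Permuting columns by kappa and rows by rho
   means the entry in position (i,j) is moved to (rho i, kappa j). *)
Definition is_symmetric_EF m (G : {set 'S_m}) (X : 'cV[R]_m -> Prop)
  d m1 m2 (Aeq : 'M[R]_(m1, d)) (beq : 'cV[R]_m1)
  (Ale : 'M[R]_(m2, d)) (ble : 'cV[R]_m2) (p : 'M[R]_(m, d)) : Prop :=
  forall pi, pi \in G ->
  exists (kappa : 'S_d) (rhoeq : 'S_m1) (rhole : 'S_m2),
    (forall y, X (p *m y) -> p *m act_cV kappa y = act_cV pi (p *m y)) /\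
    (forall i j, Aeq (rhoeq i) (kappa j) = Aeq i j) /\
    (forall i, beq (rhoeq i) 0 = beq i 0) /\
    (forall i j, Ale (rhole i) (kappa j) = Ale i j) /\
    (forall i, ble (rhole i) 0 = ble i 0).

End Permutahedron.

(* Main.v *)
(* Averaging over the finite group of pairs (pi, kappa) of compatible symmetries
   gives a section s : S_n -> Q of the projection, equivariant up to a
   permutation of the rows, so that S_n permutes the slack functions
   g_i(zeta) = b_i - (A s(zeta))_i of the inequalities.

   For every k some g_i vanishes on the facet x_1 + ... + x_k = k(k+1)/2 but not
   at the vertex obtained from (1, ..., n) by exchanging k and k+1: otherwise the
   barycentre of the facet could be moved by eps (x_id - x_(k k+1)) inside Q,
   leaving the permutahedron.

   The stabilizer U of such a g_i has index at most the number of inequalities.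
   A small-index U contains a 3-cycle (Bochert's commutator argument), and the
   maximal set C all of whose 3-cycles are in U has at least n-1 points.
   A 3-cycle of U moving both k and k+1 would contradict the choice of g_i, so U
   contains the even permutations of the complement of a point v in {k, k+1}.
   For all k of the same type (v = k or v = k+1), the translates of g_i sending v
   to the n different points are pairwise distinct, so that there are at least
   (n-1)n/2 inequalities.

   The bound d >= 2 disposes of n = 6, where the index-6 subgroup
   PGL(2,5) of S_6 contains no 3-cycle.

   Permutations compose from left to right, so act_cV s maps the vertex of zeta
   to that of zeta * s, and S_n acts on the g_i by right translation. *)
Require Import Defs.
From HB Require Import structures.
From mathcomp Require Import all_boot all_order all_algebra all_fingroup.
From mathcomp Require Import reals boolp zify ring.
Set Implicit Arguments. Unset Strict Implicit. Unset Printing Implicit Defensive.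
Import Order.TTheory GRing.Theory Num.Theory.

(** * Three-cycles in subgroups of small index *)

Ltac tperm_eval :=
  rewrite ?permM; repeat rewrite [tperm _ _ _]permE /=;
  repeat match goal with
  | |- context [?a == ?a] => rewrite eqxx /=
  | H : is_true (?a != ?b) |- context [?a == ?b] => rewrite (negbTE H) /=
  | H : is_true (?a != ?b) |- context [?b == ?a] =>
      rewrite [b == a]eq_sym (negbTE H) /=
  end.

Lemma ex_third (T : finType) (C : {set T}) x y :
  (2 < #|C|)%N -> exists z, [/\ z \in C, z != x & z != y].
Proof.
move=> C3; have [z] : exists z, z \in C :\: [set x; y].
  apply/card_gt0P; have := cardsID [set x; y] C.
  have := subset_leq_card (subsetIr C [set x; y]).
  by rewrite cards2; case: (x != y); lia.
by rewrite !inE negb_or => /andP[/andP[zx zy] zC]; exists z.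
Qed.

Lemma perm_neq1 (T : finType) (u : {perm T}) : u != 1%g -> exists x, u x != x.
Proof.
move=> u1; apply/existsP; apply: contraR u1 => /existsPn h; apply/eqP/permP => x.
by rewrite perm1; apply/eqP; move: (h x); rewrite negbK.
Qed.

Section ThreeCycles.
Local Open Scope group_scope.
Variables (T : finType) (U : {group {perm T}}).

(** Composed from left to right, the product is the 3-cycle sending [a] to [c], [c] to [b] and [b]
    to [a]. *)
Definition tri a b c : bool :=
  [&& a != b, b != c, a != c & tperm a b * tperm b c \in U].

Lemma tri_rot a b c : tri a b c -> tri b c a.
Proof.
case/and4P=> ab bc ac h; apply/and4P; split=> //; rewrite 1?eq_sym //.
by move: h; rewrite conjgC tpermJ; tperm_eval; rewrite (tpermC a).
Qed.

Lemma tri_rev a b c : tri a b c -> tri c b a.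
Proof.
case/and4P=> ab bc ac h; apply/and4P; split; rewrite 1?eq_sym //.
by rewrite -groupV invMg !tpermV (tpermC b) (tpermC c).
Qed.

Lemma triJ u a b c : u \in U -> tri a b c -> tri (u a) (u b) (u c).
Proof.
move=> uU /and4P[ab bc ac h]; rewrite /tri !(inj_eq perm_inj) ab bc ac /=.
by rewrite -!tpermJ -conjMg memJ_norm // (subsetP (normG U)).
Qed.

(** Conjugate the first 3-cycle by the second, which takes [x] to [a] and [z] to [x] and fixes
    [y]. *)
Lemma tri4 x z y a : tri x z y -> tri x z a -> y != a -> tri a x y.
Proof.
move=> h1 h2 ya; move: (h1) (h2) => /and4P[xz zy xy _] /and4P[_ za xa uU].
by have := triJ uU h1; tperm_eval.
Qed.

(** The two 3-cycles meet only in [x]. Conjugating the first by the second gives [tri q y z], which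
    [tri4] combines with [tri x y z]. *)
Lemma tri5 x y z p q : tri x y z -> tri x p q ->
  y != p -> y != q -> z != p -> z != q -> tri x y q.
Proof.
move=> h1 h2 yp yq zp zq; move: (h1) (h2) => /and4P[xy yz xz _].
case/and4P=> xp pq xq uU.
have := triJ uU h1; tperm_eval => h3.
exact/tri_rev/(tri4 (tri_rot h1) (tri_rot h3) xq).
Qed.

Definition full_on (C : {set T}) := [forall a in C, forall b in C, forall c in C,
  [&& a != b, b != c & a != c] ==> tri a b c].

Lemma full_onP (C : {set T}) : reflect (forall a b c, a \in C -> b \in C -> c \in C ->
  a != b -> b != c -> a != c -> tri a b c) (full_on C).
Proof.
apply: (iffP idP) => [h a b c aC bC cC ab bc ac | h].
  by move/'forall_in_'forall_in_'forall_in_implyP: h; apply => //; apply/and3P.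
apply/'forall_in_'forall_in_'forall_in_implyP => a aC b bC c cC /and3P[ab bc ac].
exact: h.
Qed.

Lemma full_on3 a b c : tri a b c -> full_on [set a; b; c].
Proof.
move=> h; have h1 := tri_rot h; have h2 := tri_rot h1.
have [h3 h4 h5] := And3 (tri_rev h) (tri_rev h1) (tri_rev h2).
apply/full_onP => x y z; rewrite !inE -!orbA.
by case/or3P=> /eqP -> /or3P[] /eqP -> /or3P[] /eqP ->; rewrite ?eqxx.
Qed.

(** [tri5] trades a third point outside [C] for one inside; [tri4] then replaces the points of [C]
    one at a time. *)
Lemma full_onU1 (C : {set T}) x y z : full_on C -> 2 < #|C| -> x \in C -> tri x y z ->
  full_on (y |: C).
Proof.
move=> /full_onP fC C3 xC h.
have [yC | yC] := boolP (y \in C).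
  by rewrite (setUidPr _) ?sub1set //; apply/full_onP.
have ny t : t \in C -> t != y by apply: contraTneq => ->.
have [t tC txy] : exists2 t, t \in C & tri x t y.
  have [zC | zC] := boolP (z \in C).
    by exists z => //; apply/tri_rot/tri_rot/tri_rev.
  have nz t : t \in C -> t != z by apply: contraTneq => ->.
  have [p [pC px _]] := ex_third x x C3; have [q [qC qx qp]] := ex_third x p C3.
  exists q => //; apply/tri_rot/tri_rot/tri_rev/(tri5 h (fC x p q _ _ _ _ _ _)) => //;
    rewrite 1?eq_sym //; first [exact: ny | exact: nz].
have xt : x != t by case/and4P: txy.
have two a b : a \in C -> b \in C -> a != b -> tri a b y.
  move=> aC bC ab.
  have [s sC asy] : exists2 s, s \in C & tri a s y.
    have [-> | ax] := eqVneq a x; first by exists t.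
    have [-> | at_] := eqVneq a t.
      by exists x => //; apply/tri_rot/tri_rev.
    exists x => //; apply: tri4 txy _ _; last by rewrite eq_sym ny.
    by apply: fC => //; rewrite eq_sym.
  have [-> // | bs] := eqVneq b s.
  have aS : a != s by case/and4P: asy.
  have asb : tri a s b by apply: fC => //; rewrite eq_sym.
  have := tri4 asy asb; rewrite eq_sym ny // => /(_ isT) bay.
  exact/tri_rot/tri_rev.
apply/full_onP => a b c; rewrite !inE.
move=> /orP[/eqP -> | aC] /orP[/eqP -> | bC] /orP[/eqP -> | cC];
  rewrite ?eqxx // => ab bc ac.
- by apply/tri_rot/tri_rot/two.
- by apply/tri_rot/two; rewrite 1?eq_sym.
- exact: two.
- exact: fC.
Qed.

(** [C] is a block of [U]: conjugation by [u] turns a 3-cycle on [x], [y], [z] into one through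
    [u x] and [u y], and maximality puts [u y] in [C]. *)
Lemma maxset_full_onJ (C : {set T}) u x y : maxset full_on C -> 2 < #|C| ->
  u \in U -> x \in C -> u x \in C -> y \in C -> u y \in C.
Proof.
move=> maxC C3 uU xC uxC yC; have [fC maxC'] := maxsetP maxC.
have [<- // | xy] := eqVneq x y.
have [z [zC zx zy]] := ex_third x y C3.
have h : tri x y z by apply: (full_onP _ fC) => //; rewrite eq_sym.
have fC1 := full_onU1 fC C3 uxC (triJ uU h).
by rewrite -(maxC' _ fC1 (subsetUr _ _)) setU11.
Qed.

End ThreeCycles.

(** * Upper bounds on the order of the subgroup *)

Lemma card_stab_pointed_set (T : finType) (C : {set T}) x (H : {set {perm T}}) :
  x \in C -> (forall u, u \in H -> u x = x) ->
  (forall u y, u \in H -> y \in C -> u y \in C) ->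
  (#|H| <= #|C|.-1`! * #|~: C|`!)%N.
Proof.
move=> xC fix_x stabC.
have stabC' u y : u \in H -> (u y \in C) = (y \in C).
  move=> uH; have /eqP eC : u @: C == C.
    rewrite eqEcard card_imset ?leqnn ?andbT; last exact: perm_inj.
    by apply/subsetP=> _ /imsetP[z zC ->]; apply: stabC.
  by rewrite -[in LHS]eC mem_imset //; apply: perm_inj.
have nC u : u \in H -> (u \in 'N(~: C | 'P))%g /\ (u \in 'N(C :\ x | 'P))%g.
  move=> uH; split; apply/astabsP => y; rewrite /= apermE !inE stabC' //.
  by rewrite -{1}(fix_x u uH) (inj_eq perm_inj).
(* As [u] fixes [x] and preserves [C], these two restrictions determine it. *)
pose f (u : {perm T}) := (restr_perm (C :\ x) u, restr_perm (~: C) u).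
have f_inj : {in H &, injective f}.
  move=> u v uH vH [e1 e2]; apply/permP => y.
  have [[u1 u2] [v1 v2]] := (nC u uH, nC v vH).
  have [-> | yx] := eqVneq y x; first by rewrite !fix_x.
  have [yC | yC] := boolP (y \in C).
    by rewrite -(restr_permE u2) ?e1 ?restr_permE // !inE yx.
  by rewrite -(restr_permE u1) ?e2 ?restr_permE // !inE.
rewrite -(card_in_imset f_inj).
have -> : #|C|.-1 = #|C :\ x| by rewrite (cardsD1 x C) xC.
rewrite -(card_perm (C :\ x)) -(card_perm (~: C)) -cardX.
apply: subset_leq_card; apply/subsetP => _ /imsetP[u uH ->].
by rewrite inE; apply/andP; split; apply: restr_perm_on.
Qed.

Lemma fact_mul_le a b : (2 <= a -> 2 <= b -> a`! * b`! <= 2 * (a + b - 2)`!)%N.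
Proof.
elim: a => // a IH aS b2; have [a2 | a1] := leqP 2 a; last first.
  by have -> : a = 1%N; [lia | rewrite addKn].
have := IH a2 b2; have -> : (a.+1 + b - 2 = (a + b - 2).+1)%N by lia.
rewrite !factS -mulnA => le_ab; have le : (a.+1 <= (a + b - 2).+1)%N by lia.
by rewrite (leq_trans (leq_mul le le_ab)) // mulnCA.
Qed.

Lemma fact_pred3 n : (2 < n)%N -> n`! = (n * (n - 1) * (n - 2) * (n - 3)`!)%N.
Proof. by case: n => [|[|[|n]]] // _; rewrite !factS !subSS !subn0 !mulnA. Qed.

(** Orbit-stabilizer at a point [x] of [C]: the stabilizer of [x] preserves the block [C], so the
    order of [U] is at most [n * (#|C| - 1)! * (n - #|C|)!], where [n = #|T|], and [fact_mul_le]
    applies. *)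
Lemma card_maxset_full_on (T : finType) (U : {group {perm T}}) (C : {set T}) :
  maxset (full_on U) C -> (2 < #|C|)%N -> (#|C| <= #|T| - 2)%N ->
  (#|U| * (#|T| - 1) * (#|T| - 2) <= 2 * #|T|`!)%N.
Proof.
move=> maxC C3 Cn.
have [x xC] : exists x, x \in C by apply/card_gt0P; lia.
have := @card_stab_pointed_set T C x ('C_U[x | 'P])%g xC.
rewrite -(card_orbit_stab 'P U x) => leS.
have {}leS : (#|'C_U[x | 'P]%g| <= #|C|.-1`! * #|~: C|`!)%N.
  apply: leS => [u | u y]; rewrite inE => /andP[uU /astab1P /= ux]; first exact: ux.
  have {}ux : u x = x by exact: ux.
  by apply: (maxset_full_onJ maxC C3 uU xC); rewrite ux.
have leO : (#|orbit 'P U x| <= #|T|)%N by apply: max_card.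
have eC : (#|~: C| = #|T| - #|C|)%N by have := cardsC C; lia.
have leF := @fact_mul_le #|C|.-1 #|~: C|.
have {leF}: (#|C|.-1`! * #|~: C|`! <= 2 * (#|T| - 3)`!)%N.
  have -> : (#|T| - 3 = #|C|.-1 + #|~: C| - 2)%N by lia.
  by apply: leF; lia.
move=> /(leq_trans leS)/(leq_mul leO).
rewrite (@fact_pred3 #|T|); last by lia.
set O := #|orbit _ _ _|; set S := #|('C_U[_ | _])%g|; set F := (_ - 3)`!.
set n := #|T|; move=> h.
have -> : (2 * (n * (n - 1) * (n - 2) * F) = n * (2 * F) * ((n - 1) * (n - 2)))%N by lia.
by rewrite -mulnA leq_mul.
Qed.

(** The supports of [g] and [h] meet only in [d], so their commutator is a 3-cycle on [g d], [d],
    [h d]. *)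
Lemma three_cycle_commutator (T : finType) (U : {group {perm T}}) (D : {set T}) d g h :
  d \in D -> g \in U -> h \in U -> perm_on D g -> perm_on (d |: ~: D) h ->
  g d != d -> h d != d -> exists a b c, tri U a b c.
Proof.
move=> dD gU hU gD hD gd hd.
have gout x : x \notin D -> g x = x by apply: out_perm.
have hin x : x \in D -> x != d -> h x = x.
  by move=> xD xd; apply: (out_perm hD); rewrite !inE negb_or xd xD.
have gdD : g d \in D by rewrite perm_closed.
have hdD : h d \notin D.
  by apply/negP => hdD; move/perm_inj/eqP: (hin _ hdD hd); rewrite (negbTE hd).
have ghd : g d != h d by apply: contraNneq hdD => <-.
exists (g d), d, (h d); rewrite /tri gd [d == _]eq_sym hd ghd /=.
have -> : (tperm (g d) d * tperm d (h d) = h^-1 * g^-1 * h * g)%g.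
  have hVin x : x \in D -> x != d -> (h^-1)%g x = x.
    by move=> xD xd; rewrite -{1}(hin x xD xd) permK.
  have gVout x : x \notin D -> (g^-1)%g x = x.
    by move=> xD; rewrite -{1}(gout x xD) permK.
  have hVout x : x != h d -> (x == d) || (x \notin D) -> (h^-1)%g x \notin D.
    move=> xhd xD; have hVd : (h^-1)%g x != d.
      by apply: contraNneq xhd => <-; rewrite permKV.
    apply/negP => hVD; move: (hin _ hVD hVd); rewrite permKV => e.
    by move: xD hVD hVd; rewrite -e => /orP[/eqP -> | /negbTE -> //]; rewrite eqxx.
  apply/permP => x; rewrite !permM.
  have [-> | xgd] := eqVneq x (g d).
    by rewrite hVin // permK tpermL tpermL gout.
  have [-> | xd] := eqVneq x d.
    by rewrite tpermR tpermD 1?eq_sym // gVout ?permKV // hVout ?eqxx // eq_sym.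
  rewrite (tpermD _ _ : tperm (g d) d x = x) 1?eq_sym //.
  have [-> | xhd] := eqVneq x (h d).
    rewrite permK tpermR hin ?permKV //.
      by rewrite (perm_closed _ (perm_onV gD)).
    by apply: contraNneq gd => e; rewrite -{1}e permKV.
  rewrite tpermD 1?eq_sym //.
  have [xD | xD] := boolP (x \in D).
    rewrite hVin // hin ?permKV //.
      by rewrite (perm_closed _ (perm_onV gD)).
    by apply: contraNneq xgd => <-; rewrite permKV.
  by rewrite gVout ?permKV ?gout // hVout ?xD ?orbT.
by rewrite !groupM ?groupV.
Qed.

(* D is a smallest set whose pointwise stabilizer in U is trivial. If it had more
   than half of the points, U would contain nontrivial elements supported on D
   and on d |: ~: D, whose commutator is a 3-cycle. *)
Lemma no_tri_base (T : finType) (U : {group {perm T}}) :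
  (forall a b c, ~~ tri U a b c) ->
  exists D : {set T}, (2 * #|D| <= #|T|)%N /\ (#|U| * (#|T| - #|D|)`! <= #|T|`!)%N.
Proof.
move=> noU.
pose P (D : {set T}) := [forall u in U, perm_on (~: D) u ==> (u == 1%g)].
have PT : P setT.
  apply/'forall_in_implyP => u _; rewrite setCT => h.
  by apply/eqP/permP => x; rewrite perm1 (out_perm h) ?inE.
have nP E : ~~ P E -> exists u, [/\ u \in U, perm_on (~: E) u & u != 1%g].
  by case/forallPn => u; rewrite !negb_imply => /and3P[uU uE u1]; exists u.
have [D PD minD] := arg_minnP (fun D : {set T} => #|D|) PT.
exists D; split.
  rewrite leqNgt; apply/negP => D2.
  have cD := cardsC D.
  (* [~: D] is smaller than [D], so by minimality its pointwise stabilizer is nontrivial. *)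
  have [|g [gU]] := nP (~: D).
    by apply/negP => /minD; lia.
  rewrite setCK => gD g1.
  have [d gd] := perm_neq1 g1.
  have dD : d \in D by apply: contraNT gd => dD; rewrite (out_perm gD).
  have [|h [hU]] := nP (D :\ d).
    by apply/negP => /minD; rewrite (cardsD1 d D) dD; lia.
  rewrite setCD setUC => hD h1.
  have hd : h d != d.
    apply: contra h1 => /eqP hd; move/'forall_in_implyP: PD; apply=> //.
    apply/subsetP => x hx; have /(subsetP hD) := hx; rewrite !inE => /orP[/eqP xd | //].
    by move: hx; rewrite inE xd hd eqxx.
  have [a [b [c]]] := three_cycle_commutator dD gU hU gD hD gd hd.
  exact/negP.
(* Trivial intersection makes the product of the two orders the size of a set of permutations. *)
have UI : (U :&: Sym (~: D))%g = 1%g.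
  apply/trivgP/subsetP => u; rewrite !inE => /andP[uU uD].
  by move/'forall_in_implyP: PD; apply.
have := TI_cardMg UI; rewrite card_Sym => e.
have -> : (#|T| - #|D| = #|~: D|)%N by have := cardsC D; lia.
have := card_perm [set: T]; rewrite cardsT => <-. rewrite -e.
by apply: subset_leq_card; apply/subsetP => s _; apply/subsetP => x _; rewrite inE.
Qed.

(** * Even permutations as products of 3-cycles *)

Section EvenPerms.
Variables (T : finType) (U : {group {perm T}}) (C : {set T}).
Hypothesis fC : full_on U C.

Lemma tpermM_full_on a b c d : a \in C -> b \in C -> c \in C -> d \in C ->
  a != b -> c != d -> (tperm a b * tperm c d)%g \in U.
Proof.
have share x y z : x \in C -> y \in C -> z \in C -> x != y -> y != z ->
    (tperm x y * tperm y z)%g \in U.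
  move=> xC yC zC xy yz; have [-> | xz] := eqVneq x z.
    by rewrite (tpermC z) tperm2 group1.
  by have /and4P[] := full_onP _ _ fC x y z xC yC zC xy yz xz.
move=> aC bC cC dC ab; case: (eqVneq b c) => [<- | bc] cd; first exact: share.
have -> : (tperm a b * tperm c d = (tperm a b * tperm b c) * (tperm b c * tperm c d))%g.
  by rewrite mulgA -(mulgA (tperm a b)) tperm2 mulg1.
by rewrite groupM ?share.
Qed.

Lemma even_perm_full_on u : perm_on C u -> ~~ odd_perm u -> u \in U.
Proof.
(* Strengthened for induction on the number of moved points: an odd [u] is corrected by an arbitrary
   transposition of [C]. *)
suff main : perm_on C u -> forall a b, a \in C -> b \in C -> a != b ->
    (if odd_perm u then (u * tperm a b)%g else u) \in U.
  move=> uC u0; have [-> | ] := eqVneq u 1%g; first exact: group1.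
  move=> u1; have [x ux] := perm_neq1 u1.
  have xC : x \in C by apply: contraNT ux => xC; rewrite (out_perm uC).
  have uxC : u x \in C by rewrite perm_closed.
  by have := main uC _ _ uxC xC ux; rewrite (negbTE u0).
have [m] := ubnP #|[set x | u x != x]|.
elim: m u => // m IH u; rewrite ltnS => um uC a b aC bC ab.
have [-> | u1] := eqVneq u 1%g; first by rewrite odd_perm1 group1.
have [x ux] := perm_neq1 u1.
have xC : x \in C by apply: contraNT ux => xC; rewrite (out_perm uC).
have uxC : u x \in C by rewrite perm_closed.
pose v := (u * tperm x (u x))%g.
have vC : perm_on C v.
  apply: perm_onM => //; apply: (subset_trans (tperm_on _ _)).
  by rewrite subUset !sub1set xC.
have vm : (#|[set x | v x != x]| < m)%N.
  apply: leq_trans um; apply: proper_card; apply/properP; split.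
    apply/subsetP => y; rewrite !inE permM; apply: contraNneq => uy.
    rewrite uy; case: tpermP => // yE; first by rewrite -yE uy eqxx in ux.
    have yx : y = x by apply: (@perm_inj _ u); rewrite uy.
    by rewrite -yx uy eqxx in ux.
  by exists x; rewrite !inE ?permM ?tpermR ?eqxx.
have := IH v vm vC; rewrite odd_permM odd_tperm eq_sym ux addbT.
case: (odd_perm u) => /= h; last first.
  by have := h _ _ xC uxC; rewrite eq_sym /v -mulgA tperm2 mulg1; apply.
have -> : (u * tperm a b = v * (tperm x (u x) * tperm a b))%g.
  by rewrite /v mulgA -(mulgA u) tperm2 mulg1.
by rewrite groupM ?(h a b) // tpermM_full_on // eq_sym.
Qed.

End EvenPerms.

(** * Families of functions permuted by the symmetric group *)

(** The constant 4 covers [m = 3], where 15 exceeds 12; doubled, it becomes the 8 in [Ismall]. *)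
Lemma double_choose2_le_fact m : (3 <= m)%N -> (m * (2 * m - 1) <= 2 * m`! + 4)%N.
Proof.
case: m => [|[|[|m]]] // _; elim: m => // m IH.
move: IH; rewrite [m.+4`!]factS; set f := m.+3`!.
have : (0 < f)%N by apply: fact_gt0.
nia.
Qed.

Section SymmetricFamily.
Variables (n : nat) (I : finType) (R : zmodType) (g : I -> 'S_n -> R).
Hypothesis gS : forall i (s : 'S_n), exists j, forall z, g j (z * s)%g = g i z.

Definition stabf i := [set s : 'S_n | [forall z, g i (z * s)%g == g i z]].

Lemma stabfP i (s : 'S_n) : reflect (forall z, g i (z * s)%g = g i z) (s \in stabf i).
Proof. by rewrite inE; apply: 'forall_eqP. Qed.

Lemma stabf_group_set i : group_set (stabf i).
Proof.
apply/group_setP; split=> [|s t /stabfP hs /stabfP ht]; apply/stabfP => z.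
  by rewrite mulg1.
by rewrite mulgA ht hs.
Qed.
Canonical stabf_group i := Group (stabf_group_set i).

(** Choosing an index for each translate of [g i] splits the group into at most [#|I|] fibres, each
    inside a right coset of the stabilizer. The choice need not be an action, since equal functions
    may have several indices. *)
Lemma fact_le_card_stabf i : (n`! <= #|I| * #|stabf i|)%N.
Proof.
have [j jP] := fin_all_exists (gS i).
rewrite -card_Sn -[leqLHS]sum1_card (partition_big j xpredT) //=.
rewrite -sum_nat_const; apply: leq_sum => k _; rewrite sum1_card.
have [s0 /eqP s0k | no] := pickP [pred s | j s == k]; last first.
  by rewrite (eq_card0 (A := [pred s | j s == k])).
rewrite -(card_rcoset (stabf_group i) s0); apply: subset_leq_card.
apply/subsetP => s /eqP sk; rewrite mem_rcoset; apply/stabfP => z.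
by rewrite -(jP s0) mulgA mulgKV s0k -sk jP.
Qed.

Definition preserves (K : {set 'I_n}) (y : 'S_n) : Prop :=
  forall x, (y x \in K) = (x \in K).

Lemma preserves_tperm (K : {set 'I_n}) a b :
  (a \in K) = (b \in K) -> preserves K (tperm a b).
Proof. by move=> ab x; case: tpermP => // ->. Qed.

Lemma preservesM (K : {set 'I_n}) s t :
  preserves K s -> preserves K t -> preserves K (s * t)%g.
Proof. by move=> hs ht x; rewrite permM ht hs. Qed.

(* For K the set of the first k positions, the permutations preserving K are the
   vertices of the facet on which the sum of the coordinates in K is minimal. *)
Definition detects (K : {set 'I_n}) v b i : Prop :=
  [/\ v \in K, b \notin K, (forall y, preserves K y -> g i y = 0%R)
    & g i (tperm v b) != 0%R].

(** This symmetry reduces the case of an omitted point [b] to that of an omitted point [v]. *)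
Lemma detectsC K v b i : detects K v b i -> detects (~: K) b v i.
Proof.
case=> vK bK h1 h2; split; rewrite ?inE ?vK // 1?tpermC //.
by move=> y yK; apply: h1 => x; have := yK x; rewrite !inE => /negb_inj.
Qed.

(** Multiplied by a suitable orientation of such a 3-cycle, [tperm v b] becomes a transposition of
    [z] with whichever of [v], [b] lies on its side of [K]. This preserves [K], so [g i] would
    vanish at [tperm v b]. *)
Lemma detects_tri K v b i z : detects K v b i -> ~~ tri (stabf_group i) v b z.
Proof.
case=> vK bK h1 /negP h2; apply/negP => vbz.
have [zK | zK] := boolP (z \in K).
  have /and4P[_ _ _ /stabfP/(_ (tperm v b))] := tri_rot (tri_rev vbz).
  rewrite mulgA (tpermC b) tperm2 mul1g => e; apply: h2; rewrite -e h1 //.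
  by apply: preserves_tperm; rewrite vK.
have /and4P[_ _ _ /stabfP/(_ (tperm v b))] := vbz.
rewrite mulgA tperm2 mul1g => e; apply: h2; rewrite -e h1 //.
by apply: preserves_tperm; rewrite (negbTE zK) (negbTE bK).
Qed.

Hypothesis n6 : (6 <= n)%N.
Hypothesis Ismall : (4 * #|I| + 8 < n * (n - 1))%N.

(** Otherwise [no_tri_base] gives some [m] with [n <= 2 * m] and [m!] at most [#|I|], against
    [Ismall]. *)
Lemma ex_tri i : exists a b c, tri (stabf_group i) a b c.
Proof.
have [h | h] := boolP [exists a, exists b, exists c, tri (stabf_group i) a b c].
  by have /existsP[a /existsP[b /existsP[c abc]]] := h; exists a, b, c.
have [a b c | D [D2 leD]] := @no_tri_base _ (stabf_group i).
  by apply: contraNN h => abc; apply/existsP; exists a; apply/existsP; exists b;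
    apply/existsP; exists c.
exfalso; move: leD D2 (fact_le_card_stabf i); rewrite card_ord.
have U0 : (0 < #|stabf i|)%N by apply: (cardG_gt0 (stabf_group i)).
set u := #|stabf i| in U0 *; set m := (n - _)%N => leD D2 leI.
have mI : (m`! <= #|I|)%N.
  by rewrite -(leq_pmul2l U0) (leq_trans leD) // mulnC.
have m3 : (3 <= m)%N by rewrite /m; lia.
have nm : (n <= 2 * m)%N by rewrite /m; lia.
have := double_choose2_le_fact m3.
have : (n * (n - 1) <= 2 * m * (2 * m - 1))%N by apply: leq_mul; lia.
by lia.
Qed.

Lemma detects_full_on K v b i : detects K v b i ->
  exists2 w, w \in [set v; b] & full_on (stabf_group i) (~: [set w]).
Proof.
move=> det; have [a [b' [c abc]]] := ex_tri i.
have [C maxC subC] := maxset_exists (full_on3 abc).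
have C3 : (2 < #|C|)%N.
  apply: leq_trans (subset_leq_card subC).
  have /and4P[h1 h2 h3 _] := abc.
  by rewrite -setUA cardsU1 cards2 !inE negb_or h1 h2 h3.
have fC := maxsetp maxC.
(* Otherwise the index of the stabilizer is at least [(n - 1)(n - 2) / 2], too large for [#|I|]. *)
have Cn : (n - 2 < #|C|)%N.
  rewrite ltnNge; apply/negP => Cn.
  have := card_maxset_full_on maxC C3; rewrite card_ord => /(_ Cn) /=.
  have := fact_le_card_stabf i.
  have U0 : (0 < #|stabf i|)%N by apply: (cardG_gt0 (stabf_group i)).
  set u := #|stabf i| in U0 *; set f := n`! => h1 h2.
  have : (u * ((n - 1) * (n - 2)) <= u * (2 * #|I|))%N.
    by rewrite mulnA (leq_trans h2) // mulnCA (mulnC u) leq_mul.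
  by rewrite leq_pmul2l //; nia.
have [w wvb wC] : exists2 w, w \in [set v; b] & w \notin C.
  have [vC | vC] := boolP (v \in C); last by exists v; rewrite // !inE eqxx.
  have [bC | bC] := boolP (b \in C); last by exists b; rewrite // !inE eqxx orbT.
  have vb : v != b by case: det => vK bK _ _; apply: contraNneq bK => <-.
  have [z [zC zv zb]] := ex_third v b C3.
  case/negP: (detects_tri z det).
  by apply: (full_onP _ _ fC) => //; rewrite eq_sym.
exists w => //; suff <- : C = ~: [set w] by [].
apply/eqP; rewrite eqEcard cardsC1 card_ord; apply/andP; split; last by lia.
by apply/subsetP => x xC; rewrite !inE; apply: contraNneq wC => <-.
Qed.

Lemma tri_stabfJ i1 i2 (r : 'S_n) a b c : (forall z, g i2 z = g i1 (z * r)%g) ->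
  tri (stabf_group i2) a b c -> tri (stabf_group i1) (r a) (r b) (r c).
Proof.
move=> e /and4P[ab bc ac /stabfP h]; rewrite /tri !(inj_eq perm_inj) ab bc ac /=.
apply/stabfP => z; rewrite -!tpermJ -conjMg conjgE !mulgA -e.
by have := h (z * r^-1)%g; rewrite !mulgA => ->; rewrite e mulgKV.
Qed.

Definition detects_full K v b i :=
  detects K v b i /\ full_on (stabf_group i) (~: [set v]).

(** The omitted point is determined by the function: were [r v2] another point, the stabilizer of
    [g i1] would contain a 3-cycle moving [v1] and [b1]. *)
Lemma detects_full_center K1 v1 b1 i1 K2 v2 b2 i2 (r : 'S_n) :
  detects_full K1 v1 b1 i1 -> detects_full K2 v2 b2 i2 ->
  (forall z, g i2 z = g i1 (z * r)%g) -> r v2 = v1.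
Proof.
move=> [det1 /full_onP f1] [_ /full_onP f2] e; apply/eqP/negPn/negP => wv.
have vb : v1 != b1 by case: det1 => vK bK _ _; apply: contraNneq bK => <-.
set w := r v2 in wv *.
have fw x y z : x != w -> y != w -> z != w -> x != y -> y != z -> x != z ->
    tri (stabf_group i1) x y z.
  move=> xw yw zw xy yz xz; rewrite -(permKV r x) -(permKV r y) -(permKV r z).
  apply: (tri_stabfJ e); apply: f2; rewrite ?inE ?(inj_eq perm_inj) //.
  - by apply: contraNneq xw => e1; rewrite /w -e1 permKV.
  - by apply: contraNneq yw => e1; rewrite /w -e1 permKV.
  - by apply: contraNneq zw => e1; rewrite /w -e1 permKV.
have C3 : (2 < #|~: [set v1; b1]|)%N.
  by have := cardsC [set v1; b1]; rewrite cards2 card_ord vb; lia.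
have [z [zC zw _]] := ex_third w w C3.
have [x [xC xw xz]] := ex_third w z C3.
move: zC xC; rewrite !inE !negb_or => /andP[zv zb] /andP[xv xb].
(* If [w = b1], the 3-cycle is built from one on [x], [z], [b1], avoiding [v1], and one on [x], [z],
   [v1], avoiding [w]. *)
have [bw | bw] := eqVneq b1 w; last first.
  by case/negP: (detects_tri z det1); apply: fw; rewrite // eq_sym.
case/negP: (detects_tri x det1); apply/tri_rev/tri_rot.
apply: (tri4 (z := z)); last by rewrite eq_sym; exact: vb.
  by apply: f1; rewrite ?inE // 1?eq_sym.
by apply: fw; rewrite // eq_sym.
Qed.

(** For [y] as below, [tperm v1 b1 * y * r] is even and fixes [v1], hence stabilizes [g i1]. So
    [g i1] takes the same value at [tperm v1 b1] as at [y * r], namely [g i2 y = 0]. *)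
Lemma detects_full_nested K1 v1 b1 i1 K2 v2 b2 i2 (r : 'S_n) :
  detects_full K1 v1 b1 i1 -> detects_full K2 v2 b2 i2 ->
  (forall z, g i2 z = g i1 (z * r)%g) -> ~~ (b1 |: K1 \subset K2).
Proof.
move=> df1 df2 e; have rv := detects_full_center df1 df2 e.
case: df1 df2 => -[vK1 bK1 _ /negP nz] f1 [[vK2 bK2 zK2 _] _].
apply/negP; rewrite subUset sub1set => /andP[b1K2 _].
have [y [yK yb ev]] : exists y : 'S_n, [/\ preserves K2 y, y b1 = v2 &
    ~~ odd_perm (tperm v1 b1 * y * r)%g].
  pose y := tperm b1 v2.
  have yK : preserves K2 y by apply: preserves_tperm; rewrite b1K2.
  have [od | ev] := boolP (odd_perm (tperm v1 b1 * y * r)%g); last first.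
    by exists y; rewrite ?tpermL.
  (* A transposition inside one side of [K2] corrects the parity; one side has three points, leaving
     two besides [b1]. *)
  have [p [q [pb qb pq pqK]]] :
      exists p q, [/\ p != b1, q != b1, p != q & (p \in K2) = (q \in K2)].
    have [K3 | K3] := ltnP 2 #|K2|.
      have [p [pK pb _]] := ex_third b1 b1 K3; have [q [qK qb qp]] := ex_third b1 p K3.
      by exists p, q; split; rewrite ?pK ?qK // eq_sym.
    have K3' : (2 < #|~: K2|)%N.
      by have := cardsC K2; rewrite card_ord; lia.
    have [p [pK pb _]] := ex_third b1 b1 K3'; have [q [qK qb qp]] := ex_third b1 p K3'.
    move: pK qK; rewrite !inE => /negbTE pK /negbTE qK.
    by exists p, q; split; rewrite ?pK ?qK // eq_sym.
  exists (tperm p q * y)%g; split.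
  - by apply: preservesM => //; apply: preserves_tperm.
  - by rewrite permM tpermD // tpermL.
  - move: od; rewrite !odd_permM (odd_tperm p q) pq.
    by move: (odd_perm y) (odd_perm r) (odd_perm (tperm _ _)); do 3!case.
have uU : (tperm v1 b1 * y * r)%g \in stabf_group i1.
  apply: (even_perm_full_on f1) => //; apply/subsetP => x; rewrite !inE.
  by apply: contraNneq => ->; rewrite !permM tpermL yb rv.
apply: nz; have /stabfP/(_ (tperm v1 b1)) <- := uU.
by rewrite !mulgA tperm2 mul1g -e zK2.
Qed.

(** The translates of [g (i k)] moving the omitted point to each [w] are pairwise distinct: [w] is
    recovered by [detects_full_center], and [k] by [detects_full_nested]. *)
Lemma card_detects_full (J : finType) (K : J -> {set 'I_n}) v b i :
  (forall k, detects_full (K k) (v k) (b k) (i k)) ->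
  (forall k k', k != k' ->
    (b k |: K k \subset K k') \/ (b k' |: K k' \subset K k)) ->
  (#|J| * n <= #|I|)%N.
Proof.
move=> det nest.
have /fin_all_exists[f fP] : forall kw : J * 'I_n, exists j,
    forall z, g j (z * tperm (v kw.1) kw.2)%g = g (i kw.1) z by move=> kw.
have f_inj : injective f.
  move=> [k w] [k' w'] ff.
  have e (k1 k2 : J) w1 w2 : f (k1, w1) = f (k2, w2) ->
      forall z, g (i k2) z = g (i k1) (z * (tperm (v k2) w2 * tperm (v k1) w1))%g.
    move=> ef z; rewrite -(fP (k2, w2)) -ef -(fP (k1, w1)) /= !mulgA.
    by rewrite -(mulgA _ (tperm (v k1) w1)) tperm2 mulg1.
  have kk : k = k'.
    apply/eqP/negPn/negP => /nest[].
      exact/negP/(detects_full_nested (det k) (det k') (e _ _ _ _ ff)).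
    exact/negP/(detects_full_nested (det k') (det k) (e _ _ _ _ (esym ff))).
  rewrite -kk in ff *; congr (_, _).
  have := detects_full_center (det k) (det k) (e _ _ _ _ ff).
  rewrite permM tpermL => /(canRL (tpermK _ _)).
  by rewrite tpermL => ->.
by have := leq_card f f_inj; rewrite card_prod card_ord.
Qed.

End SymmetricFamily.

Lemma card_symmetric_detecting m (I : finType) (R : zmodType)
    (g : I -> 'S_m.+1 -> R) : (6 <= m.+1)%N ->
  (forall i (s : 'S_m.+1), exists j, forall z, g j (z * s)%g = g i z) ->
  (forall k : 'I_m, exists i,
     detects g [set x : 'I_m.+1 | x <= k]%N (inord k) (inord k.+1) i) ->
  (m.+1 * m <= 4 * #|I| + 8)%N.
Proof.
move=> n6 gS det; rewrite leqNgt; apply/negP => Ismall.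
have {}Ismall : (4 * #|I| + 8 < m.+1 * (m.+1 - 1))%N by rewrite subn1.
pose K (k : 'I_m) := [set x : 'I_m.+1 | x <= k]%N.
pose v (k : 'I_m) : 'I_m.+1 := inord k.
pose b (k : 'I_m) : 'I_m.+1 := inord k.+1.
have vE k : v k = k :> nat by rewrite inordK // ltnW // ltnS.
have bE k : b k = k.+1 :> nat by rewrite inordK // ltnS.
(* The boolean records which of [v k], [b k] is omitted; in the second case the complements form the
   chain. *)
pose P (k : 'I_m) (it : I * bool) := if it.2 then detects_full g (K k) (v k) (b k) it.1
  else detects_full g (~: K k) (b k) (v k) it.1.
have /fin_all_exists[it itP] : forall k, exists it, P k it.
  move=> k; have [i det_i] := det k.
  have [w] := detects_full_on gS n6 Ismall det_i.
  rewrite !inE => /orP[/eqP -> | /eqP ->] f; first by exists (i, true).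
  by exists (i, false); split=> //; apply: detectsC.
have leT : (#|{: {k : 'I_m | (it k).2}}| * m.+1 <= #|I|)%N.
  apply: (@card_detects_full _ _ _ _ gS n6 Ismall _ (fun k => K (val k))
    (fun k => v (val k)) (fun k => b (val k)) (fun k => (it (val k)).1)).
    by move=> [k kt] /=; have := itP k; rewrite /P kt.
  have main (k k' : 'I_m) : (k < k')%N -> b k |: K k \subset K k'.
    move=> kk'; apply/subsetP => x; rewrite !inE => /orP[/eqP -> |]; first by rewrite bE.
    by move/leq_trans; apply; apply: ltnW.
  move=> [k kt] [k' kt'] /=; rewrite -val_eqE /= => ne.
  have [kk | kk | /val_inj kk] := ltngtP k k'; last by rewrite kk eqxx in ne.
    by left; apply: main.
  by right; apply: main.
have leF : (#|{: {k : 'I_m | ~~ (it k).2}}| * m.+1 <= #|I|)%N.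
  apply: (@card_detects_full _ _ _ _ gS n6 Ismall _ (fun k => ~: K (val k))
    (fun k => b (val k)) (fun k => v (val k)) (fun k => (it (val k)).1)).
    by move=> [k kt] /=; have := itP k; rewrite /P (negbTE kt).
  have main (k k' : 'I_m) : (k < k')%N -> v k' |: ~: K k' \subset ~: K k.
    move=> kk'; apply/subsetP => x; rewrite !inE -!ltnNge => /orP[/eqP -> |].
      by rewrite vE.
    by apply: ltn_trans.
  move=> [k kt] [k' kt'] /=; rewrite -val_eqE /= => ne.
  have [kk | kk | /val_inj kk] := ltngtP k k'; last by rewrite kk eqxx in ne.
    by right; apply: main.
  by left; apply: main.
have := cardC [pred k : 'I_m | (it k).2]; rewrite card_ord.
move: leT leF; rewrite !card_sig => leT leF cT.
have : (m * m.+1 <= 2 * #|I|)%N by rewrite -{1}cT mulnDl mul2n -addnn leq_add.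
by lia.
Qed.

(** * Symmetric extended formulations *)

Local Open Scope ring_scope.

Section Permutahedron.
Variable R : realType.

Lemma act_cVM k (s t : 'S_k) (x : 'cV[R]_k) : act_cV (s * t)%g x = act_cV t (act_cV s x).
Proof. by apply/colP => v; rewrite !mxE invMg permM. Qed.

Lemma act_cV1 k (x : 'cV[R]_k) : act_cV 1%g x = x.
Proof. by apply/colP => v; rewrite !mxE invg1 perm1. Qed.

Lemma act_perm_vertex n (s z : 'S_n) :
  act_cV s (perm_vertex R z) = perm_vertex R (z * s)%g.
Proof. by apply/colP => v; rewrite !mxE invMg permM. Qed.

Lemma mulmx_act_cV m d (A : 'M[R]_(m, d)) (r : 'S_m) (k : 'S_d) (y : 'cV_d) i :
  (forall i j, A (r i) (k j) = A i j) -> (A *m act_cV k y) (r i) 0 = (A *m y) i 0.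
Proof.
move=> Ark; rewrite !mxE (reindex_inj (@perm_inj _ k)) /=.
by apply: eq_bigr => j _; rewrite Ark mxE permK.
Qed.

Lemma perm_vertex_in n (z : 'S_n) : permutahedron (perm_vertex R z).
Proof.
exists (fun t => (t == z)%:R); split=> [t|]; first exact: ler0n.
split; first by rewrite (bigD1 z) //= eqxx big1 ?addr0 // => t /negbTE ->.
by rewrite (bigD1 z) //= eqxx scale1r big1 ?addr0 // => t /negbTE ->; rewrite scale0r.
Qed.

Section Formulation.
Variables (n d m1 m2 : nat) (Aeq : 'M[R]_(m1, d)) (beq : 'cV[R]_m1)
  (Ale : 'M[R]_(m2, d)) (ble : 'cV[R]_m2) (p : 'M[R]_(n, d)).

Definition slack (y : 'cV[R]_d) i : R := ble i 0 - (Ale *m y) i 0.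

Section Combination.
Variables (J : finType) (P : pred J) (c : J -> R) (y : J -> 'cV[R]_d).
Hypothesis c1 : \sum_(j | P j) c j = 1.

Lemma slack_combo i :
  slack (\sum_(j | P j) c j *: y j) i = \sum_(j | P j) c j * slack (y j) i.
Proof.
rewrite /slack mulmx_sumr summxE.
under [RHS]eq_bigr do rewrite mulrBr.
rewrite sumrB -mulr_suml c1 mul1r; congr (_ - _).
by apply: eq_bigr => j _; rewrite -scalemxAr mxE.
Qed.

(** Coefficients may be negative, as at [t] in [ex_detects]; only the combined slacks must be
    nonnegative. *)
Lemma EF_sol_combo : (forall j, P j -> Aeq *m y j = beq) ->
  (forall i, 0 <= \sum_(j | P j) c j * slack (y j) i) ->
  EF_sol Aeq beq Ale ble (\sum_(j | P j) c j *: y j).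
Proof.
move=> yeq yge; split=> [|i]; last by rewrite -subr_ge0 -/(slack _ i) slack_combo.
rewrite mulmx_sumr -[RHS]scale1r -c1 scaler_suml.
by apply: eq_bigr => j Pj; rewrite -scalemxAr yeq.
Qed.

End Combination.

(** The column permutations granted for each element of ['S_n] need not form a homomorphism; all
    compatible pairs together do form a group. *)
Definition symmetry_pair (t : 'S_n * 'S_d) : Prop :=
  [/\ forall y, @perm_vertices R n (p *m y) -> p *m act_cV t.2 y = act_cV t.1 (p *m y),
      exists r : 'S_m1, (forall i j, Aeq (r i) (t.2 j) = Aeq i j) /\
                        (forall i, beq (r i) 0 = beq i 0)
    & exists r : 'S_m2, (forall i j, Ale (r i) (t.2 j) = Ale i j) /\
                        (forall i, ble (r i) 0 = ble i 0)].

Definition symmetry_pairs := [set t | `[< symmetry_pair t >]].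

Lemma symmetry_pairs_group_set : group_set symmetry_pairs.
Proof.
apply/group_setP; split=> [|[s k] [s' k']]; rewrite !inE.
  apply/asboolP; split=> [y _||]; first by rewrite !act_cV1.
  - by exists 1%g; split=> *; rewrite !perm1.
  - by exists 1%g; split=> *; rewrite !perm1.
move=> /asboolP[h [r [hA hb]] [q [gA gb]]] /asboolP[h' [r' [hA' hb']] [q' [gA' gb']]].
apply/asboolP; split=> [y Xy||] /=.
- rewrite !act_cVM h' /= ?h //= .
  by have [z ->] := Xy; rewrite act_perm_vertex; exists (z * s)%g.
- by exists (r * r')%g; split=> *; rewrite !permM ?hA' ?hA ?hb' ?hb.
- by exists (q * q')%g; split=> *; rewrite !permM ?gA' ?gA ?gb' ?gb.
Qed.
Canonical symmetry_pairs_group := Group symmetry_pairs_group_set.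

Lemma slack_symmetry t : symmetry_pair t ->
  exists r : 'S_m2, forall y i, slack (act_cV t.2 y) (r i) = slack y i.
Proof.
by case=> _ _ [r [hA hb]]; exists r => y i; rewrite /slack mulmx_act_cV // hb.
Qed.

Lemma EF_sol_symmetry t y : symmetry_pair t ->
  EF_sol Aeq beq Ale ble y -> EF_sol Aeq beq Ale ble (act_cV t.2 y).
Proof.
case=> _ [r [hA hb]] [q [gA gb]] [yeq yle]; split=> [|i].
  apply/colP => i; rewrite -(permKV r i) mulmx_act_cV //.
  by rewrite yeq hb.
by rewrite -(permKV q i) mulmx_act_cV // gb.
Qed.

Hypothesis hEF : is_extended_formulation (@permutahedron R n) Aeq beq Ale ble p.
Hypothesis hsym : is_symmetric_EF [set: 'S_n] (@perm_vertices R n) Aeq beq Ale ble p.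

Lemma symmetric_section : exists s : 'S_n -> 'cV[R]_d,
  [/\ forall z, EF_sol Aeq beq Ale ble (s z),
      forall z, p *m s z = perm_vertex R z
    & forall i (t : 'S_n), exists j, forall z, slack (s (z * t)%g) j = slack (s z) i].
Proof.
have [y0 [y0sol py0]] := (hEF (perm_vertex R 1%g)).1 (perm_vertex_in _).
have lift (t : 'S_n) : exists k : 'S_d, (t, k) \in symmetry_pairs.
  have [k [r [q [h1 [h2 [h3 [h4 h5]]]]]]] := hsym (in_setT t).
  by exists k; rewrite inE; apply/asboolP; split=> //; [exists r | exists q].
(* [s z] averages the images of [y0], a point above the identity vertex, over the pairs lying above
   [z]. *)
pose F (z : 'S_n) := [pred t | (t \in symmetry_pairs) && (t.1 == z)].
pose w z : R := #|F z|%:R^-1.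
pose s z := \sum_(t | F z t) w z *: act_cV t.2 y0.
have F0 z : (0 < #|F z|)%N.
  by apply/card_gt0P; have [k zk] := lift z; exists (z, k); rewrite inE /= zk eqxx.
have w1 z : \sum_(t | F z t) w z = 1.
  by rewrite sumr_const -mulr_natl mulfV // pnatr_eq0 -lt0n F0.
have w0 z : 0 <= w z by rewrite invr_ge0 ler0n.
have solF t : t \in symmetry_pairs -> EF_sol Aeq beq Ale ble (act_cV t.2 y0).
  by rewrite inE => /asboolP h; apply: EF_sol_symmetry.
exists s; split=> [z | z | i t].
- apply: EF_sol_combo => // [t /andP[tS _]|i]; first by have [] := solF t tS.
  apply: sumr_ge0 => t /andP[tS _]; rewrite mulr_ge0 // subr_ge0.
  by have [_] := solF t tS.
- rewrite mulmx_sumr -[RHS]scale1r -(w1 z) scaler_suml.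
  apply: eq_bigr => t /andP[]; rewrite inE -scalemxAr => /asboolP[h _ _] /eqP tz.
  by rewrite h py0 ?act_perm_vertex ?mul1g ?tz //; exists 1%g.
have [k tk] := lift t; move: (tk); rewrite inE => /asboolP /slack_symmetry[r hr].
exists (r i) => z.
(* Right multiplication by [(t, k)] maps the pairs above [z] bijectively to those above [z * t]. *)
have reF (G : 'S_n * 'S_d -> R) : \sum_(u | F (z * t)%g u) G u =
    \sum_(u | F z u) G (u * (t, k))%g.
  rewrite (reindex_inj (mulIg (t, k))) /=; apply: eq_bigl => u.
  by rewrite /F /= (groupMr u tk) (inj_eq (mulIg t)).
have ww : w (z * t)%g = w z.
  rewrite /w; congr (_^-1).
  by rewrite -!sum1_card !natr_sum reF.
rewrite !slack_combo // reF; apply: eq_bigr => u _.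
by rewrite ww /= act_cVM hr.
Qed.

End Formulation.
End Permutahedron.

(** * Facet inequalities of the permutahedron *)

Section Facets.
Variables (R : realType) (n k : nat).
Local Notation K := [set x : 'I_n | (x <= k)%N].

(** Indices start at 0, so for [k < n] the set [K] consists of the first [k + 1] positions. *)
Definition facet_form (x : 'cV[R]_n) : R := \sum_(v in K) x v 0.

Lemma facet_form_sum (J : finType) (c : J -> R) (y : J -> 'cV[R]_n) :
  facet_form (\sum_j c j *: y j) = \sum_j c j * facet_form (y j).
Proof.
rewrite /facet_form; under eq_bigr do rewrite summxE.
rewrite exchange_big; apply: eq_bigr => j _ /=.
by rewrite mulr_sumr; apply: eq_bigr => v _; rewrite mxE.
Qed.

Lemma facet_form_vertex (z : 'S_n) :
  facet_form (perm_vertex R z) = (\sum_(v in K) ((z^-1)%g v).+1)%:R.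
Proof. by rewrite natr_sum; apply: eq_bigr => v _; rewrite mxE. Qed.

(* Truncated subtraction: k.+1 - v vanishes outside K, so its sum over K is
   invariant under permuting the values, while (k.+1 - a) + a >= k.+1. *)
Lemma facet_form_ge (z : 'S_n) :
  facet_form (perm_vertex R 1%g) <= facet_form (perm_vertex R z).
Proof.
rewrite !facet_form_vertex ler_nat.
under eq_bigr do rewrite invg1 perm1 -add1n.
under [leqRHS]eq_bigr do rewrite -add1n.
rewrite !big_split leq_add2l /=.
have eK : (\sum_(v in K) (v + (k.+1 - v)) = \sum_(v in K) k.+1)%N.
  by apply: eq_bigr => v; rewrite inE => vk; rewrite subnKC // ltnW.
have leK : (\sum_(v in K) k.+1 <= \sum_(v in K) ((z^-1)%g v + (k.+1 - (z^-1)%g v)))%N.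
  by apply: leq_sum => v _; lia.
have leT : (\sum_(v in K) (k.+1 - (z^-1)%g v) <= \sum_(v in K) (k.+1 - v))%N.
  have -> : (\sum_(v in K) (k.+1 - v) = \sum_(v < n) (k.+1 - v))%N.
    rewrite [RHS](bigID (mem K)) /= [X in (_ + X)%N]big1 ?addn0 // => v.
    by rewrite inE; lia.
  rewrite [leqRHS](reindex_inj (@perm_inj _ (z^-1)%g)) /=.
  by rewrite [leqRHS](bigID (mem K)) leq_addr.
move: eK leK leT; rewrite !big_split /=.
set a := (\sum_(v in K) v)%N; set b := (\sum_(v in K) (k.+1 - v))%N.
set a' := (\sum_(v in K) (z^-1)%g v)%N; set b' := (\sum_(v in K) (k.+1 - (z^-1)%g v))%N.
lia.
Qed.

Lemma facet_form_preserves (z : 'S_n) : preserves K z ->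
  facet_form (perm_vertex R z) = facet_form (perm_vertex R 1%g).
Proof.
move=> zK; rewrite !facet_form_vertex; congr _%:R.
rewrite (reindex_inj (@perm_inj _ z)) /=.
by apply: eq_big => v; rewrite ?zK // permK invg1 perm1.
Qed.

Lemma facet_form_tperm (a b : 'I_n) : a = k :> nat -> b = k.+1 :> nat ->
  facet_form (perm_vertex R (tperm a b)) = facet_form (perm_vertex R 1%g) + 1.
Proof.
move=> ak bk; rewrite !facet_form_vertex natr1; congr _%:R.
have aK : a \in K by rewrite inE ak.
rewrite (bigD1 a) //= [in RHS](bigD1 a) //= tpermV tpermL invg1 perm1 ak bk.
rewrite -[RHS]addSn; congr (_ + _)%N.
apply: eq_bigr => v /andP[]; rewrite inE => vk va.
by rewrite perm1 tpermD // 1?eq_sym // -val_eqE /= bk; lia.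
Qed.

Lemma facet_form_permutahedron (x : 'cV[R]_n) : permutahedron x ->
  facet_form (perm_vertex R 1%g) <= facet_form x.
Proof.
case=> lam [lam0 [lam1 ->]]; rewrite facet_form_sum -[leLHS]mul1r -lam1 mulr_suml.
by apply: ler_sum => z _; rewrite ler_wpM2l // facet_form_ge.
Qed.

End Facets.

(** * Inequalities detecting a facet *)

Section Detection.
Variables (R : realType) (m d m1 m2 : nat) (Aeq : 'M[R]_(m1, d)) (beq : 'cV[R]_m1)
  (Ale : 'M[R]_(m2, d)) (ble : 'cV[R]_m2) (p : 'M[R]_(m.+1, d)).
Hypothesis hEF : is_extended_formulation (@permutahedron R m.+1) Aeq beq Ale ble p.
Variable s : 'S_m.+1 -> 'cV[R]_d.
Hypothesis s_sol : forall z, EF_sol Aeq beq Ale ble (s z).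
Hypothesis ps : forall z, p *m s z = perm_vertex R z.

Lemma ex_detects (k : 'I_m) : exists i,
  detects (fun i z => slack Ale ble (s z) i)
    [set x : 'I_m.+1 | x <= k]%N (inord k) (inord k.+1) i.
Proof.
apply: contrapT => nodet; set K := [set x | _] in nodet.
set g := (fun i z => _) in nodet.
pose v : 'I_m.+1 := inord k; pose b : 'I_m.+1 := inord k.+1.
have vE : v = k :> nat by rewrite inordK // ltnW // ltnS.
have bE : b = k.+1 :> nat by rewrite inordK // ltnS.
pose t := tperm v b.
have g0 i z : 0 <= g i z by rewrite subr_ge0; have [] := s_sol z.
have gt i : (forall y, preserves K y -> g i y = 0) -> g i t = 0.
  move=> h; apply/eqP/negPn/negP => gt; apply: nodet; exists i; split=> //.
    by rewrite inE vE.
  by rewrite inE -ltnNge bE.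
pose Y := [set y : 'S_m.+1 | [forall x, (y x \in K) == (x \in K)]].
have YP y : reflect (preserves K y) (y \in Y) by rewrite inE; apply: 'forall_eqP.
have Y1 : 1%g \in Y by apply/YP => x; rewrite perm1.
pose N : R := #|Y|%:R.
have N0 : 0 < N by rewrite ltr0n; apply/card_gt0P; exists 1%g.
pose M i := \sum_(y in Y) g i y.
have M0 i : 0 <= M i by apply: sumr_ge0.
(* D is large enough for D M - g(t) to be nonnegative in every row. *)
pose D := 1 + \sum_i g i t / M i.
have D0 : 0 < D by rewrite ltr_pwDl // sumr_ge0 // => i _; rewrite divr_ge0.
have DM i : g i t <= D * M i.
  (* If [M i = 0], row [i] has zero slack on [Y], hence at [t]; division by zero makes its term in
     [D] vanish. *)
  have [Mi | Mi] := eqVneq (M i) 0.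
    rewrite gt ?Mi ?mulr0 // => y /YP yY.
    move/eqP: Mi; rewrite psumr_eq0 // => /allP/(_ y (mem_index_enum _)).
    by rewrite yY => /eqP.
  have Mpos : 0 < M i by rewrite lt_def Mi M0.
  rewrite -ler_pdivrMr // /D (bigD1 i) //= addrCA lerDl addr_ge0 // sumr_ge0 // => j _.
  by rewrite divr_ge0.
(* Weights of the barycentre of [Y], moved by [1 / (D * N)] times vertex [1] minus vertex [t]; this
   lowers [facet_form] by [1 / (D * N)]. *)
pose c (z : 'S_m.+1) : R :=
  (D * N)^-1 * (D * (z \in Y)%:R + (z == 1%g)%:R - (z == t)%:R).
have csum (f : 'S_m.+1 -> R) : \sum_z c z * f z =
    (D * N)^-1 * (D * (\sum_(y in Y) f y) + f 1%g - f t).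
  have delta z0 : \sum_z (z == z0)%:R * f z = f z0.
    rewrite (bigD1 z0) //= eqxx mul1r big1 ?addr0 // => z /negbTE ->.
    by rewrite mul0r.
  under eq_bigr => z _ do
    (have -> : c z * f z = (D * N)^-1 * (D * ((z \in Y)%:R * f z)
       + (z == 1%g)%:R * f z - (z == t)%:R * f z) by rewrite /c; ring).
  rewrite -mulr_sumr sumrB big_split /= !delta -mulr_sumr; congr (_ * (_ * _ + _ - _)).
  rewrite [RHS]big_mkcond; apply: eq_bigr => z _.
  by case: (z \in Y); rewrite ?mul1r ?mul0r.
have DN : D * N != 0 by rewrite mulf_neq0 ?gt_eqF.
have c1 : \sum_z c z = 1.
  have := csum (fun=> 1); under eq_bigr do rewrite mulr1; move=> ->.
  by rewrite addrK sumr_const -/N mulVf.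
have sol : EF_sol Aeq beq Ale ble (\sum_z c z *: s z).
  apply: EF_sol_combo => // [z _|i]; first by have [] := s_sol z.
  rewrite csum mulr_ge0 //; first by rewrite invr_ge0 mulr_ge0 // ltW.
  by rewrite addrAC addr_ge0 ?g0 // subr_ge0 DM.
have xP : permutahedron (\sum_z c z *: perm_vertex R z).
  apply/hEF; exists (\sum_z c z *: s z); split=> //.
  by rewrite mulmx_sumr; apply: eq_bigr => z _; rewrite -scalemxAr ps.
have := facet_form_permutahedron k xP; rewrite facet_form_sum csum.
rewrite (facet_form_tperm _ vE bE).
have -> : \sum_(y in Y) facet_form k (perm_vertex R y) =
    \sum_(y in Y) facet_form k (perm_vertex R (1%g : 'S_m.+1)).
  by apply: eq_bigr => y /YP yY; apply: facet_form_preserves.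
rewrite sumr_const -mulr_natl -/N.
set L := facet_form _ _.
have -> : (D * N)^-1 * (D * (N * L) + L - (L + 1)) = L - (D * N)^-1.
  by field; rewrite !gt_eqF.
by rewrite lerBrDr gerDl invr_le0 leNgt mulr_gt0.
Qed.

End Detection.

(** For [d <= 1] the 2 by 2 minors of projected points vanish, but the identity vertex and its swap
    of the first two coordinates would give [1 * 1 = 2 * 2]. *)
Lemma permutahedron_dim_ge2 (R : realType) n d m1 m2
    (Aeq : 'M[R]_(m1, d)) (beq : 'cV[R]_m1) (Ale : 'M[R]_(m2, d)) (ble : 'cV[R]_m2) (p : 'M[R]_(n, d)) : (2 <= n)%N ->
  is_extended_formulation (@permutahedron R n) Aeq beq Ale ble p -> (2 <= d)%N.
Proof.
case: n p => [|[|n]] // p _ hEF; rewrite ltnNge; apply/negP => d1.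
have rank1 (y y' : 'cV[R]_d) i j :
    (p *m y) i 0 * (p *m y') j 0 = (p *m y) j 0 * (p *m y') i 0.
  clear hEF; case: d d1 p y y' {Aeq Ale} => [|[|d]] // _ p y y'.
    by rewrite !mxE !big_ord0 !mul0r.
  by rewrite !mxE !big_ord1; ring.
pose a : 'I_n.+2 := ord0; pose b : 'I_n.+2 := inord 1.
have bE : b = 1%N :> nat by rewrite inordK.
have [y [_ py]] := (hEF _).1 (perm_vertex_in R 1%g).
have [y' [_ py']] := (hEF _).1 (perm_vertex_in R (tperm a b)).
have := rank1 y y' a b; rewrite py py' !mxE invg1 !perm1 tpermV tpermL tpermR bE /=.
by move=> /eqP; rewrite -!natrM eqr_nat.
Qed.

(* d variables, m1 equations, m2 inequalities; the number of variables plus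
   constraints d + m1 + m2 is at least n(n-1)/4, i.e. 4(d+m1+m2) >= n(n-1). *)
Theorem theorem11 (R : realType) (n : nat) (hn : (6 <= n)%N)
  (d m1 m2 : nat) (Aeq : 'M[R]_(m1, d)) (beq : 'cV[R]_m1)
  (Ale : 'M[R]_(m2, d)) (ble : 'cV[R]_m2) (p : 'M[R]_(n, d)) :
  is_extended_formulation (@permutahedron R n) Aeq beq Ale ble p ->
  is_symmetric_EF [set: 'S_n] (@perm_vertices R n) Aeq beq Ale ble p ->
  (n * (n - 1) <= 4 * (d + m1 + m2))%N.
Proof.
case: n hn p => // m hn p hEF hsym.
have d2 := permutahedron_dim_ge2 (ltnW (ltnW (ltnW (ltnW hn)))) hEF.
have [s [s_sol ps s_sym]] := symmetric_section hEF hsym.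
have := card_symmetric_detecting hn s_sym (ex_detects hEF s_sol ps).
(* The additive 8 is absorbed by [4 * d], as [d >= 2]. *)
rewrite card_ord subn1 /=; lia.
Qed.
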